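(* Let $\alpha=(\alpha_n)_{n\in\mathbb{N}}\in\ell^2$ and let $f_\alpha(z)=\sum_{n\ge0}\alpha_n z^n$. The following statements are equivalent: (i) the Rhaly operator $R_\alpha$, $(R_\alpha f)(k)=\alpha_k\sum_{j=0}^k f(j)$, is bounded on $\ell^2$; (ii) $f_\alpha$ belongs to $\Lambda^2_{1/2}$; (iii) $\displaystyle\sup_{n\in\mathbb{N}} 2^n\sum_{j=2^n}^{2^{n+1}-1}|\alpha_j|^2<\infty$.
   Context: $\mathbb{N}=\{0,1,2,\dots\}$; $\ell^2$ is the Hilbert space of square-summable functions $f:\mathbb{N}\to\mathbb{C}$. For $\alpha\in\ell^2$, $f_\alpha\in H^2$ (the Hardy space of the unit disc) and is identified with its boundary function on the unit circle $\mathbb{T}$. The mean Lipschitz space is $\Lambda^2_{1/2}=\{f\in L^2(\mathbb{T}): \sup_{t\in[-\pi,\pi]}|t|^{-1/2}\|f_t-f\|_{L^2}<\infty\}$, where $f_t(e^{i\theta})=f(e^{i(\theta-t)})$. *)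

(* Defs.v *)
From HB Require Import structures.
From mathcomp Require Import all_boot all_order all_algebra.
From mathcomp Require Import all_classical all_reals all_analysis.
From mathcomp Require Import complex.
Set Implicit Arguments. Unset Strict Implicit. Unset Printing Implicit Defensive.
Import Order.TTheory GRing.Theory Num.Theory.
Import numFieldNormedType.Exports.
Local Open Scope classical_set_scope.
Local Open Scope ring_scope.

Definition sqmod {R : realType} (z : R[i]) : R := (complex.Re z) ^+ 2 + (complex.Im z) ^+ 2.

Definition l2sq {R : realType} (f : nat -> R[i]) : \bar R :=
  (\sum_(0 <= k <oo) (sqmod (f k))%:E)%E.

Definition in_l2 {R : realType} (f : nat -> R[i]) : Prop := (l2sq f < +oo)%E.

Definition rhaly {R : realType} (alpha f : nat -> R[i]) : nat -> R[i] :=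
  fun k => alpha k * \sum_(0 <= j < k.+1) f j.

Definition rhaly_bounded {R : realType} (alpha : nat -> R[i]) : Prop :=
  exists M : R, forall f : nat -> R[i], in_l2 f ->
    (l2sq (rhaly alpha f) <= M%:E * l2sq f)%E.

Definition expi {R : realType} (x : R) : R[i] := (cos x +i* sin x)%C.

Definition psum {R : realType} (alpha : nat -> R[i]) (N : nat) (theta : R) : R[i] :=
  \sum_(0 <= n < N) alpha n * expi (n%:R * theta).

Definition Tint (R : realType) : set R := `[(- pi)%R, pi%R]%classic.

(* squared L^2(T) norm (normalized measure d theta / 2 pi) of a function on T,
   represented as a 2pi-periodic function on R *)
Definition L2Tsq {R : realType} (g : R -> R[i]) : \bar R :=
  ((2 * pi)^-1)%:E *
  (\int[@lebesgue_measure R]_(x in @Tint R) (sqmod (g x))%:E)%E.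

Definition periodic2pi {R : realType} (g : R -> R[i]) : Prop :=
  forall x : R, g (x + 2 * pi) = g x.

Definition meas_on_T {R : realType} (g : R -> R[i]) : Prop :=
  periodic2pi g /\ measurable_fun setT (fun x => complex.Re (g x))
                /\ measurable_fun setT (fun x => complex.Im (g x)).

Definition boundary_fun {R : realType} (alpha : nat -> R[i]) (F : R -> R[i]) : Prop :=
  meas_on_T F /\
  (fun N => L2Tsq (fun x => psum alpha N x - F x)) @ \oo --> 0%E.

(* membership in the mean Lipschitz space Lambda^2_{1/2}:
   sup_{t in [-pi,pi]} |t|^{-1/2} ||F_t - F||_{L^2} < oo, with F_t(theta) = F(theta - t),
   written as ||F_t - F||_{L^2}^2 <= M |t| (and F in L^2) *)
Definition in_Lambda2_half {R : realType} (F : R -> R[i]) : Prop :=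
  meas_on_T F /\ (L2Tsq F < +oo)%E /\
  exists M : R, forall t : R, - pi <= t <= pi ->
    (L2Tsq (fun x : R => (F (x - t) - F x)%R) <= (M * `|t|)%:E)%E.

(* Main.v *)
Require Import Defs.
From HB Require Import structures.
From mathcomp Require Import all_boot all_order all_algebra.
From mathcomp Require Import all_classical all_reals all_analysis.
From mathcomp Require Import complex.
From mathcomp Require Import measurable_realfun ring lra.
Import Order.TTheory GRing.Theory Num.Theory.
Import numFieldNormedType.Exports.
Local Open Scope ring_scope.

(** (i) => (iii): test the operator on the indicator function of [0, 2^n).

    (iii) => (i): if [s_n] is the sum of [|f|] over [0, 2^n) and [F_n] the sum of
    [|f|^2] over [2^n, 2^(n+1)), then [T_n = s_n^2 / 2^n] satisfies
    [T_(n+1) <= 3/4 T_n + 3/2 F_n], so that [\sum T_n] is bounded by a multiple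
    of [||f||^2].  The dyadic condition makes the n-th block of [||R f||^2] at
    most a multiple of [T_(n+1)].

    (ii) <=> (iii): let [P_N] be the partial sums of the Fourier series.  By
    Parseval for trigonometric polynomials, [||P_N(. - t) - P_N||^2] is the sum
    of [|alpha_n|^2 |e^(-int) - 1|^2] over [n < N]; it is compared with
    [||F(. - t) - F||^2] through the triangle inequality and the translation
    invariance of the norm, with an error that vanishes as N grows.  For (iii)
    take [t = pi / 2^(n+1)], where the multiplier is at least 2 on the n-th
    dyadic block; conversely bound the multiplier by [min(4, n^2 t^2)] and sum
    over the blocks.  The boundary function F is constructed from (iii) as the
    almost everywhere limit of [P_(2^k)], and Fatou's lemma gives convergence of
    [P_N] to F in L^2. *)

(** * Dyadic sums *)

Section dyadic_sums.
Context {R : realFieldType}.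
Implicit Types (u w : nat -> R) (M t : R).

(** Cauchy-Schwarz by induction: when a term [a] is appended to a sum [s] of [k] terms, the cross
    term [2 * s * a] is absorbed through [(s - k * a) ^+ 2 >= 0]. *)
Lemma sqr_sum_le u (m n : nat) :
  (\sum_(m <= j < m + n) u j) ^+ 2 <= n%:R * \sum_(m <= j < m + n) u j ^+ 2.
Proof.
elim: n => [|n IH]; first by rewrite addn0 !big_geq// mul0r expr0n.
rewrite addnS !big_nat_recr ?leq_addr//=.
case: n IH => [|n] IH; first by rewrite addn0 !big_geq// !add0r mul1r.
move: IH; rewrite -[n.+2]addn1 natrD.
set s := bigop _ _ _; set q := bigop _ _ _; set k := n.+1%:R => IH.
have k0 : 0 < k by rewrite ltr0n.
set a := u _.
have : 2 * s * a <= q + k * a ^+ 2.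
  rewrite -(ler_pM2l k0); have := sqr_ge0 (s - k * a); nra.
nra.
Qed.

Lemma big_dyadic (h : nat -> R) (K : nat) :
  \sum_(1 <= k < 2 ^ K) h k = \sum_(0 <= n < K) \sum_(2 ^ n <= k < 2 ^ n.+1) h k.
Proof.
elim: K => [|K IH]; first by rewrite !big_geq.
by rewrite big_nat_recr//= -IH -big_cat_nat// ?expn_gt0// leq_exp2l.
Qed.

(** This is the [T_n] of the overview: [2 ^ n] times the square of the mean of [|u|] over the first
    [2 ^ n] indices. *)
Definition dyadic_avg u (n : nat) : R :=
  (\sum_(0 <= j < 2 ^ n) `|u j|) ^+ 2 / 2 ^+ n.

(** Split the longer sum as [s + b]. From [(s - 2 * b) ^+ 2 >= 0] comes [(s + b) ^+ 2 <= 3 / 2 * s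
    ^+ 2 + 3 * b ^+ 2], and Cauchy-Schwarz bounds [b ^+ 2]; these weights leave a factor below 1 on
    [dyadic_avg u n]. *)
Lemma dyadic_avgS u (n : nat) : dyadic_avg u n.+1 <=
  3 / 4 * dyadic_avg u n + 3 / 2 * \sum_(2 ^ n <= j < 2 ^ n.+1) u j ^+ 2.
Proof.
have le2 : (2 ^ n <= 2 ^ n.+1)%N by rewrite leq_exp2l.
have e2 : (2 ^ n.+1 = 2 ^ n + 2 ^ n)%N by rewrite expnS mul2n addnn.
rewrite /dyadic_avg (@big_cat_nat _ _ _ (2 ^ n) 0 (2 ^ n.+1))//=.
have := sqr_sum_le (fun j => `|u j|) (2 ^ n) (2 ^ n).
under [X in _ * X]eq_bigr do rewrite real_normK ?num_real//.
rewrite -e2 natrX (exprS 2 n).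
set b := bigop _ _ _; set F := bigop _ _ _; set s := bigop _ _ _.
have d0 : 0 < 2 ^+ n :> R by rewrite exprn_gt0.
set d := 2 ^+ n in d0 * => bF.
rewrite ler_pdivrMr ?mulr_gt0//.
have -> : (3 / 4 * (s ^+ 2 / d) + 3 / 2 * F) * (2 * d) =
          3 / 2 * s ^+ 2 + 3 * (d * F) by field; rewrite gt_eqF.
have := sqr_ge0 (s - 2 * b); nra.
Qed.

(** The extra [3 * dyadic_avg u K] lets the induction close, since the recursion reads
    [4 T_(K+1) <= 3 T_K + 6 F_K]. *)
Lemma sum_dyadic_avg u (K : nat) :
  \sum_(0 <= n < K) dyadic_avg u n.+1 + 3 * dyadic_avg u K <=
  6 * \sum_(0 <= j < 2 ^ K) u j ^+ 2.
Proof.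
elim: K => [|K IH].
  rewrite big_geq// /dyadic_avg !expn0 expr0 !big_nat1 divr1.
  rewrite real_normK ?num_real//; have := sqr_ge0 (u 0%N); lra.
rewrite big_nat_recr//= (@big_cat_nat _ _ _ (2 ^ K) 0 (2 ^ K.+1))//=.
  have := dyadic_avgS u K; lra.
by rewrite leq_exp2l.
Qed.

Lemma dyadic_avg_ge0 u n : 0 <= dyadic_avg u n.
Proof. by rewrite divr_ge0 ?sqr_ge0// exprn_ge0. Qed.

(** Condition (iii) with [w j] for [|alpha_j|^2]. Index 0 lies in no dyadic block, so the estimates
    below treat it separately. *)
Definition dyadic_bound w M :=
  forall n, (2 ^ n)%:R * \sum_(2 ^ n <= j < 2 ^ n.+1) w j <= M.

(** On the n-th block each partial sum is at most the sum of [|u|] over [[0, 2 ^ n.+1)], so the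
    block costs at most [2 * M * dyadic_avg u n.+1]; summing with [sum_dyadic_avg] gives
    [12 = 2 * 6]. *)
Lemma weighted_hardy u w M (K : nat) : (forall n, 0 <= w n) ->
  dyadic_bound w M ->
  \sum_(0 <= k < 2 ^ K) w k * (\sum_(0 <= j < k.+1) u j) ^+ 2 <=
  (w 0%N + 12 * M) * \sum_(0 <= j < 2 ^ K) u j ^+ 2.
Proof.
move=> w0 wM.
have M0 : 0 <= M by apply: le_trans (wM 0%N); rewrite mulr_ge0// sumr_ge0.
rewrite big_ltn ?expn_gt0//= big_nat1 big_dyadic mulrDl; apply: lerD.
  rewrite ler_wpM2l// big_ltn ?expn_gt0// lerDl sumr_ge0// => i _.
  exact: sqr_ge0.
have blk n : \sum_(2 ^ n <= k < 2 ^ n.+1) w k * (\sum_(0 <= j < k.+1) u j) ^+ 2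
    <= 2 * M * dyadic_avg u n.+1.
  apply: (@le_trans _ _ ((\sum_(2 ^ n <= k < 2 ^ n.+1) w k) *
      (\sum_(0 <= j < 2 ^ n.+1) `|u j|) ^+ 2)).
    rewrite mulr_suml; apply: ler_sum_nat => k /andP[_ kn].
    rewrite ler_wpM2l// -[leLHS]real_normK ?num_real// lerXn2r ?nnegrE//.
      by rewrite sumr_ge0.
    apply: le_trans (ler_norm_sum _ _ _) _.
    by rewrite [leRHS](@big_cat_nat _ _ _ k.+1)//= lerDl sumr_ge0.
  have := wM n; rewrite natrX /dyadic_avg (exprS 2 n).
  set W := bigop _ _ _; set s := (X in X ^+ 2).
  have d0 : 0 < 2 ^+ n :> R by rewrite exprn_gt0.
  set d := 2 ^+ n in d0 * => dW.
  have -> : 2 * M * (s ^+ 2 / (2 * d)) = M * s ^+ 2 / d by field; rewrite gt_eqF.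
  by rewrite ler_pdivlMr// mulrAC ler_wpM2r ?sqr_ge0// mulrC.
apply: le_trans (ler_sum _ (fun n _ => blk n)) _.
rewrite -mulr_sumr.
have := sum_dyadic_avg u K; have := dyadic_avg_ge0 u K.
set T := dyadic_avg _ _; set A := bigop _ _ _; set Q := bigop _ _ _ => *.
nra.
Qed.

Lemma sum_geometric_le (r : R) n : 0 <= r < 1 ->
  \sum_(0 <= k < n) r ^+ k <= (1 - r)^-1.
Proof.
move=> /andP[r0 r1]; have r1' : 0 < 1 - r by rewrite subr_gt0.
rewrite -[leRHS]mul1r ler_pdivlMr//.
have -> : (\sum_(0 <= k < n) r ^+ k) * (1 - r) = 1 - r ^+ n.
  elim: n => [|n IH]; first by rewrite big_geq// expr0; ring.
  by rewrite big_nat_recr//= mulrDl IH exprS; ring.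
by rewrite gerBl exprn_ge0.
Qed.

(** The two entries of the minimum cross near [2 ^+ m = 1 / t], and the terms decay geometrically
    away from there, whence a total linear in [t]. *)
Lemma sum_min_dyadic t (K : nat) : 0 < t ->
  \sum_(0 <= m < K) Num.min (2 ^- m : R) (2 ^+ m * t ^+ 2) <= 3 * t.
Proof.
have bnd2 (s : R) L :
    \sum_(0 <= m < L) Num.min (2 ^- m : R) (2 ^+ m * s ^+ 2) <= 2.
  apply: (@le_trans _ _ (\sum_(0 <= m < L) 2^-1 ^+ m)).
    by apply: ler_sum => m _; rewrite exprVn ge_min lexx.
  have e2 : (1 - 2^-1)^-1 = 2 :> R by field.
  by rewrite -[leRHS]e2; apply: sum_geometric_le; lra.
(* [3 s - s ^+ 2] is a supersolution of the scaling recursion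
   [phi s = s ^+ 2 + phi (2 * s) / 2] that the sum satisfies for [s < 1]. *)
suff small (s : R) L : 0 < s <= 2 ->
    \sum_(0 <= m < L) Num.min (2 ^- m : R) (2 ^+ m * s ^+ 2) <= 3 * s - s ^+ 2.
  move=> t0; have [t2|t2] := leP t 2.
    have := small t K; rewrite t0 t2 => /(_ isT); have := sqr_ge0 t; lra.
  have := bnd2 t K; lra.
elim: L s => [|L IH] s /andP[s0 s2]; first by rewrite big_geq//; nra.
(* On [[1, 2]] the uniform bound 2 suffices: [3 * s - s ^+ 2 - 2 = (s - 1) * (2 - s) >= 0]. *)
have [s1|s1] := leP 1 s; first by apply: le_trans (bnd2 s _) _; nra.
rewrite big_nat_recl//= expr0 invr1 mul1r.
have -> : Num.min 1 (s ^+ 2) = s ^+ 2 by apply/min_idPr; nra.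
have -> : \sum_(0 <= m < L) Num.min (2 ^- m.+1 : R) (2 ^+ m.+1 * s ^+ 2) =
    2^-1 * \sum_(0 <= m < L) Num.min (2 ^- m : R) (2 ^+ m * (2 * s) ^+ 2).
  rewrite mulr_sumr; apply: eq_bigr => m _.
  rewrite minr_pMr// !(exprS 2 m) invfM; congr Num.min; field;
    rewrite ?expf_neq0 ?pnatr_eq0//.
have := IH (2 * s); have -> : 0 < 2 * s <= 2 by lra.
move=> /(_ isT); nra.
Qed.

(** Here [k n] stands for the multiplier [|e^(-int) - 1|^2]. On the m-th block [n < 2 ^ m.+1], hence
    [k n <= 4 * min(1, (2 ^ m * t) ^+ 2)], while the weights sum to at most [M / 2 ^ m]; the
    constant is [12 = 4 * 3]. *)
Lemma dyadic_lipschitz_sum w (k : nat -> R) M t (N : nat) :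
  (forall n, 0 <= w n) -> dyadic_bound w M -> 0 <= t ->
  (forall n, 0 <= k n <= 4) -> (forall n, k n <= (n%:R * t) ^+ 2) ->
  \sum_(0 <= n < N) w n * k n <= 12 * M * t.
Proof.
move=> w0 wM; rewrite le_eqVlt => /predU1P[<-|t0] k4 kt.
  rewrite mulr0 big1// => n _.
  have -> : k n = 0; last by rewrite mulr0.
  apply/le_anti; have /andP[-> _] := k4 n.
  by have := kt n; rewrite mulr0 expr0n andbT.
have wk0 n : 0 <= w n * k n by rewrite mulr_ge0//; have /andP[] := k4 n.
have M0 : 0 <= M by apply: le_trans (wM 0%N); rewrite mulr_ge0// sumr_ge0.
apply: (@le_trans _ _ (\sum_(0 <= n < 2 ^ N) w n * k n)).
  by rewrite [leRHS](@big_cat_nat _ _ _ N)//= ?lerDl ?sumr_ge0// ltnW// ltn_expl.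
rewrite big_ltn ?expn_gt0//= big_dyadic.
have -> : k 0%N = 0.
  apply/le_anti; have /andP[-> _] := k4 0%N.
  by have := kt 0%N; rewrite mul0r expr0n andbT.
rewrite mulr0 add0r.
have blk m : \sum_(2 ^ m <= n < 2 ^ m.+1) w n * k n <=
    4 * M * Num.min (2 ^- m : R) (2 ^+ m * t ^+ 2).
  have d0 : 0 < 2 ^+ m :> R by rewrite exprn_gt0.
  have Wd : \sum_(2 ^ m <= n < 2 ^ m.+1) w n <= M / 2 ^+ m.
    by rewrite ler_pdivlMr// mulrC -natrX.
  have aux c : 0 <= c -> (forall n, (2 ^ m <= n < 2 ^ m.+1)%N -> k n <= 4 * c) ->
      \sum_(2 ^ m <= n < 2 ^ m.+1) w n * k n <= 4 * M * (2 ^- m * c).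
    move=> c0 kc.
    apply: (@le_trans _ _ ((\sum_(2 ^ m <= n < 2 ^ m.+1) w n) * (4 * c))).
      by rewrite mulr_suml; apply: ler_sum_nat => n nm; rewrite ler_wpM2l// kc.
    have -> : 4 * M * (2 ^- m * c) = M / 2 ^+ m * (4 * c) by ring.
    by rewrite ler_wpM2r// mulr_ge0.
  rewrite minEle; case: ifP => _.
    rewrite -[X in _ * X]mulr1; apply: aux => // n _.
    by rewrite mulr1; have /andP[] := k4 n.
  have -> : 2 ^+ m * t ^+ 2 = 2 ^- m * (2 ^+ m * t) ^+ 2.
    by rewrite exprMn expr2 !mulrA mulVf ?gt_eqF// mul1r.
  apply: aux => [|n /andP[_ nm]]; first exact: sqr_ge0.
  apply: le_trans (kt n) _.
  have -> : 4 * (2 ^+ m * t) ^+ 2 = ((2 ^ m.+1)%:R * t) ^+ 2 :> R.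
    by rewrite natrX (exprS 2 m); ring.
  rewrite lerXn2r ?nnegrE ?mulr_ge0// ?(ltW t0)// ler_wpM2r ?(ltW t0)//.
  by rewrite ler_nat ltnW.
apply: le_trans (ler_sum _ (fun n _ => blk n)) _.
rewrite -mulr_sumr; have := sum_min_dyadic t N t0.
set A := bigop _ _ _; nra.
Qed.
End dyadic_sums.

(** * The Rhaly operator *)

Section sqmod.
Context {R : realType}.
Implicit Types (x y z : R[i]) (f alpha : nat -> R[i]).

Lemma sqmod_ge0 z : 0 <= sqmod z.
Proof. by rewrite addr_ge0 ?sqr_ge0. Qed.

Lemma sqmodM x y : sqmod (x * y) = sqmod x * sqmod y.
Proof. by case: x y => [a b] [c d]; rewrite /sqmod /=; ring. Qed.

Lemma sqmodN z : sqmod (- z) = sqmod z.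
Proof. by case: z => [a b]; rewrite /sqmod /= !sqrrN. Qed.

Lemma sqmodD3_le x y z :
  sqmod (x + y + z) <= 3 * (sqmod x + sqmod y + sqmod z).
Proof.
case: x y z => [a a'] [b b'] [c c']; rewrite /sqmod /=.
have h (p q r : R) : (p + q + r) ^+ 2 <= 3 * (p ^+ 2 + q ^+ 2 + r ^+ 2).
  have := sqr_ge0 (p - q); have := sqr_ge0 (q - r); have := sqr_ge0 (p - r).
  nra.
have := h a b c; have := h a' b' c'; lra.
Qed.

Lemma sqmod_sum (I : Type) (r : seq I) (F : I -> R[i]) :
  sqmod (\sum_(i <- r) F i) = (\sum_(i <- r) complex.Re (F i)) ^+ 2 +
                              (\sum_(i <- r) complex.Im (F i)) ^+ 2.
Proof. by rewrite /sqmod !raddf_sum. Qed.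

Lemma l2sq_ge_psum f n : ((\sum_(0 <= k < n) sqmod (f k))%:E <= l2sq f)%E.
Proof.
rewrite -sumEFin; apply: nneseries_lim_ge => k _ _.
by rewrite lee_fin sqmod_ge0.
Qed.

Lemma l2sq_le f (a : \bar R) :
  (forall n, ((\sum_(0 <= k < n) sqmod (f k))%:E <= a)%E) -> (l2sq f <= a)%E.
Proof.
move=> fa; apply: lime_le.
  by apply: is_cvg_nneseries => k _ _; rewrite lee_fin sqmod_ge0.
by apply: nearW => n; rewrite sumEFin.
Qed.

(** For the indicator [f] of [[0, 2 ^ n)] the squared norm is [2 ^ n], and [rhaly alpha f k] is
    [2 ^ n * alpha k] whenever [2 ^ n <= k]. Keeping only the n-th block, one factor [2 ^ n]
    cancels. *)
Lemma rhaly_bounded_dyadic alpha : rhaly_bounded alpha ->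
  exists M : R, dyadic_bound (fun j => sqmod (alpha j)) M.
Proof.
move=> [M hM]; exists M => n.
pose f j : R[i] := if (j < 2 ^ n)%N then 1 else 0.
have sf j : sqmod (f j) = if (j < 2 ^ n)%N then 1 else 0.
  by rewrite /f; case: ifP; rewrite /sqmod /= !(expr0n, expr1n, addr0).
have pf m : \sum_(0 <= k < m) sqmod (f k) = (minn m (2 ^ n))%:R.
  elim: m => [|m IH]; first by rewrite big_geq// min0n.
  rewrite big_nat_recr//= IH sf; case: ltnP => h.
    by rewrite (minn_idPl _)// ?(minn_idPl h) ?(ltnW h)// -natr1.
  by rewrite !(minn_idPr _)// ?addr0// ltnW.
have lf : (l2sq f <= (2 ^ n)%:R%:E)%E.
  by apply: l2sq_le => m; rewrite pf lee_fin ler_nat geq_minr.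
have lf0 : (l2sq f = (2 ^ n)%:R%:E)%E.
  apply/le_anti; rewrite lf/=; have := l2sq_ge_psum f (2 ^ n).
  by rewrite pf minnn.
have := hM f (le_lt_trans lf (ltry _)); rewrite lf0 -EFinM => h.
have := le_trans (l2sq_ge_psum (rhaly alpha f) (2 ^ n.+1)) h; rewrite lee_fin.
have le2 : (2 ^ n <= 2 ^ n.+1)%N by rewrite leq_exp2l.
rewrite (@big_cat_nat _ _ _ (2 ^ n))//= => {}h.
have {h} : \sum_(2 ^ n <= k < 2 ^ n.+1) sqmod (rhaly alpha f k) <= M * (2 ^ n)%:R.
  apply: le_trans h; rewrite lerDr sumr_ge0// => i _; exact: sqmod_ge0.
rewrite (eq_big_nat _ _ (F2 := fun k => sqmod (alpha k) * (2 ^ n)%:R ^+ 2)).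
  rewrite -mulr_suml expr2 mulrA ler_pM2r ?ltr0n ?expn_gt0//.
  by rewrite mulrC.
move=> k /andP[nk _]; rewrite /rhaly sqmodM; congr (_ * _).
have -> : \sum_(0 <= j < k.+1) f j = (2 ^ n)%:R.
  rewrite (@big_cat_nat _ _ _ (2 ^ n))//= ?(leqW nk)//.
  rewrite [X in _ + X]big_nat_cond [X in _ + X]big1 ?addr0.
    transitivity (\sum_(0 <= j < 2 ^ n) (1 : R[i])).
      by apply: eq_big_nat => j /andP[_ jn]; rewrite /f jn.
    by rewrite big_const_nat iter_addr addr0 subn0.
  by move=> j /andP[/andP[nj _] _]; rewrite /f ltnNge nj.
by rewrite /sqmod raddfMn /= [complex.Im _]raddfMn /= mul0rn expr0n addr0.
Qed.

(** The real and imaginary parts of [f] each obey [weighted_hardy]; sums up to [n] are enlarged to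
    [2 ^ n] to fit the blocks. *)
Lemma dyadic_rhaly_bounded alpha (M : R) :
  dyadic_bound (fun j => sqmod (alpha j)) M -> rhaly_bounded alpha.
Proof.
move=> hM; exists (sqmod (alpha 0%N) + 12 * M) => f f2.
have w0 n : 0 <= sqmod (alpha n) by exact: sqmod_ge0.
have M0 : 0 <= M by apply: le_trans (hM 0%N); rewrite mulr_ge0// sumr_ge0.
apply: l2sq_le => n.
apply: (@le_trans _ _ ((sqmod (alpha 0%N) + 12 * M)%:E *
    (\sum_(0 <= j < 2 ^ n) sqmod (f j))%:E)%E); last first.
  apply: lee_wpmul2l; last exact: l2sq_ge_psum.
  by rewrite lee_fin addr_ge0// mulr_ge0.
rewrite -EFinM lee_fin.
apply: (@le_trans _ _ (\sum_(0 <= k < 2 ^ n) sqmod (rhaly alpha f k))).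
  rewrite [leRHS](@big_cat_nat _ _ _ n)//= ?lerDl ?sumr_ge0//.
    by move=> k _; exact: sqmod_ge0.
  by rewrite ltnW// ltn_expl.
under eq_bigr do rewrite /rhaly sqmodM sqmod_sum mulrDr.
rewrite [in leRHS]/sqmod !big_split/= mulrDr.
by apply: lerD; exact: weighted_hardy.
Qed.

End sqmod.

(** * Trigonometric polynomials *)

Section expi.
Context {R : realType}.
Implicit Types (x y t : R) (n : nat) (c : nat -> R[i]).

Lemma sqmod_expi x : sqmod (expi x) = 1.
Proof. by rewrite /sqmod /= cos2Dsin2. Qed.

Lemma expiD x y : expi (x + y) = expi x * expi y.
Proof.
rewrite /expi cosD sinD; apply/eqP; rewrite eq_complex /= eqxx/=.
by rewrite addrC.
Qed.

Lemma expi_periodic n x : expi (n%:R * (x + 2 * pi)) = expi (n%:R * x).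
Proof.
have -> : n%:R * (x + 2 * pi) = n%:R * x + pi *+ 2 *+ n.
  by rewrite -mulrnA -(mulr_natl pi) natrM; ring.
by rewrite /expi (periodicn (@cosD2pi R)) (periodicn (@sinD2pi R)).
Qed.

Lemma psumB_shift c (N : nat) x t :
  psum c N (x - t) - psum c N x =
  psum (fun n => c n * (expi (- (n%:R * t)) - 1)) N x.
Proof.
rewrite /psum -sumrB; apply: eq_bigr => n _.
by rewrite mulrBr -mulrN expiD; ring.
Qed.

Lemma sqmod_expiN1 x : sqmod (expi (- x) - 1) = 2 - 2 * cos x.
Proof.
rewrite /sqmod /= cosN sinN oppr0 addr0 sqrrN.
by have := cos2Dsin2 x; nra.
Qed.

(** Mean value theorem: [sin x = cos y * x] for some [y]; evenness in [x] reduces to [0 < x]. *)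
Lemma sqr_sin_le x : sin x ^+ 2 <= x ^+ 2.
Proof.
wlog x0 : x / 0 < x => [h|].
  have [/h//|x0|<-] := ltgtP 0 x; last by rewrite sin0.
  by have := h (- x); rewrite oppr_gt0 sinN !sqrrN; exact.
have csin : {within `[0, x]%classic, continuous (@sin R)}%classic.
  by apply: continuous_subspaceT; exact: continuous_sin.
have [y _] := MVT x0 (fun y _ => is_derive_sin y) csin.
by rewrite sin0 !subr0 => ->; rewrite exprMn ler_piMl ?sqr_ge0//.
Qed.

(** By the half-angle formula the left side is [4 * sin (x / 2) ^+ 2]. *)
Lemma sqmod_expiN1_le x : sqmod (expi (- x) - 1) <= x ^+ 2.
Proof.
rewrite sqmod_expiN1; have := sqr_sin_le (x / 2).
have -> : cos x = cos (x / 2 *+ 2) by rewrite -mulr_natr divfK// pnatr_eq0.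
by rewrite cos_mulr2n; have := cos2Dsin2 (x / 2); nra.
Qed.

Lemma sqmod_expiN1_le4 x : sqmod (expi (- x) - 1) <= 4.
Proof. by rewrite sqmod_expiN1; have := cos_geN1 x; lra. Qed.

Lemma sqmod_expiN1_ge2 x : pi / 2 <= x <= pi -> 2 <= sqmod (expi (- x) - 1).
Proof.
move=> /andP[x1 x2]; rewrite sqmod_expiN1.
have : 0 <= sin (x - pi / 2) by apply: sin_ge0_pi; have := pi_ge0 R; lra.
rewrite sinBpihalf; lra.
Qed.

Lemma sinMpi n : sin (n%:R * pi) = 0 :> R.
Proof.
elim: n => [|n IH]; first by rewrite mul0r sin0.
by rewrite -natr1 mulrDl mul1r sinDpi IH oppr0.
Qed.

End expi.

(** * Parseval's identity for trigonometric polynomials *)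

Section parseval.
Context {R : realType}.
Implicit Types (g G : R -> R) (c : nat -> R[i]).

(** A primitive with equal values at the endpoints reduces the vanishing of the integral over
    [[-pi, pi]] to the fundamental theorem of calculus. *)
Definition zero_mean g := continuous g /\
  exists2 G : R -> R, (forall x : R, is_derive x 1 G (g x)) & G pi = G (- pi).

Lemma zero_meanD g1 g2 :
  zero_mean g1 -> zero_mean g2 -> zero_mean (fun x => g1 x + g2 x).
Proof.
move=> [c1 [G1 d1 e1]] [c2 [G2 d2 e2]]; split.
  by move=> x; apply: cvgD; [exact: c1|exact: c2].
exists (G1 + G2); last by rewrite !fctE e1 e2.
by move=> x; exact: is_deriveD.
Qed.

Lemma zero_mean_trig (a b : R) (k : nat) : (0 < k)%N ->
  zero_mean (fun x => a * cos (k%:R * x) + b * sin (k%:R * x)).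
Proof.
move=> k0; have kn0 : k%:R != 0 :> R by rewrite pnatr_eq0 -lt0n.
have dk (x : R) : is_derive x 1 ( *%R (k%:R : R)) (k%:R : R).
  have := @is_deriveZ R R R id k%:R x 1 1 _.
  by rewrite -[k%:R *: 1]/(k%:R * 1) mulr1; exact.
have ck : continuous ( *%R (k%:R : R)) by exact: mulrl_continuous.
split.
  move=> x; apply: cvgD; apply: cvgM; try exact: cvg_cst.
    by apply: continuous_comp; [exact: ck|exact: continuous_cos].
  by apply: continuous_comp; [exact: ck|exact: continuous_sin].
exists ((a / k%:R) \*: (sin \o *%R k%:R) - (b / k%:R) \*: (cos \o *%R k%:R)).
  move=> x.
  have ds : is_derive x 1 (sin \o *%R k%:R) (cos (k%:R * x) * k%:R).
    exact: is_derive1_comp.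
  have dc : is_derive x 1 (cos \o *%R k%:R) (- sin (k%:R * x) * k%:R).
    exact: is_derive1_comp.
  apply: is_derive_eq.
  rewrite /GRing.scale/=; field.
  exact: kn0.
by rewrite !fctE /= mulrN cosN sinN sinMpi oppr0.
Qed.

Lemma sqmodD_dot (x y : R[i]) : sqmod (x + y) = sqmod x + sqmod y +
  2 * (complex.Re x * complex.Re y + complex.Im x * complex.Im y).
Proof. by case: x y => [a b] [c d]; rewrite /sqmod /=; ring. Qed.

Lemma psumS c N x : psum c N.+1 x = psum c N x + c N * expi (N%:R * x).
Proof. by rewrite /psum big_nat_recr. Qed.

(** This is the cross term of [sqmodD_dot]. Every frequency [j] in [psum c n] is below [N], so its
    product with the term of frequency [N] oscillates at frequency [N - j > 0]. *)
Lemma zero_mean_cross c (d : R[i]) (n N : nat) : (n <= N)%N ->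
  zero_mean (fun x => 2 *
   (complex.Re (psum c n x) * complex.Re (d * expi (N%:R * x)) +
    complex.Im (psum c n x) * complex.Im (d * expi (N%:R * x)))).
Proof.
elim: n => [_|n IH nN].
  rewrite (_ : (fun _ => _) = (fun x => 0 * cos (1%:R * x) + 0 * sin (1%:R * x))).
    exact: zero_mean_trig.
  by apply/funext => x; rewrite /psum big_geq//=; ring.
case cn : (c n) => [p q]; case: d IH => r s IH.
(* With [c n = p + iq] and [d = r + is], these are the coefficients of twice the real part of
   [(p - iq)(r + is) e^(i(N - n)x)]. *)
have := zero_meanD _ _ (IH (ltnW nN)) (zero_mean_trig (2 * (p * r + q * s))
  (2 * (q * r - p * s)) (N - n) _).
rewrite subn_gt0 => /(_ nN); congr zero_mean; apply/funext => x.
rewrite psumS natrB ?(ltnW nN)// mulrBl cosB sinB /=.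
rewrite cn /= !raddfD /=; ring.
Qed.

(** Pointwise form of Parseval: the diagonal terms of the square are constant and the off-diagonal
    ones have zero mean. *)
Lemma sqmod_psum c N : exists2 g, zero_mean g &
  forall x, sqmod (psum c N x) = \sum_(0 <= n < N) sqmod (c n) + g x.
Proof.
elim: N => [|N [g g0 gE]].
  exists (fun x => 0 * cos (1%:R * x) + 0 * sin (1%:R * x)).
    exact: zero_mean_trig.
  by move=> x; rewrite /psum !big_geq// /sqmod /=; ring.
exists (fun x => g x + 2 *
   (complex.Re (psum c N x) * complex.Re (c N * expi (N%:R * x)) +
    complex.Im (psum c N x) * complex.Im (c N * expi (N%:R * x)))).
  by apply: zero_meanD => //; exact: zero_mean_cross.
move=> x; rewrite psumS sqmodD_dot gE sqmodM sqmod_expi mulr1 big_nat_recr//=.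
by set X := 2 * _; ring.
Qed.

Lemma integral_zero_mean (a : R) g : zero_mean g ->
  (\int[lebesgue_measure]_(x in @Tint R) (a + g x)%:E = (2 * pi * a)%:E)%E.
Proof.
move=> [cg [G dG eG]].
pose H := a \*: id + G.
have dH (x : R) : is_derive x 1 H (a + g x).
  have da : is_derive x 1 (a \*: id) a.
    have := @is_deriveZ R R R id a x 1 1 _.
    by rewrite /GRing.scale/= mulr1; exact.
  exact: is_deriveD.
have cH : continuous H.
  move=> x; apply: differentiable_continuous; apply/derivable1_diffP.
  by have [] := dH x.
rewrite /Tint (@continuous_FTC2 _ (fun x => a + g x) H).
- by rewrite /H !fctE /= eG -EFinB; congr EFin; rewrite /GRing.scale/=; ring.
- by rewrite gtrN// pi_gt0.
- apply: continuous_subspaceT => x; apply: cvgD; first exact: cvg_cst.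
  exact: cg.
- split; first by move=> x _; have [] := dH x.
  + exact: cvg_at_right_filter (cH _).
  + exact: cvg_at_left_filter (cH _).
- by move=> x _; rewrite derive1E; have [_ ->] := dH x.
Qed.

Lemma L2Tsq_psum c N : L2Tsq (psum c N) = (\sum_(0 <= n < N) sqmod (c n))%:E.
Proof.
rewrite /L2Tsq; have [g g0 gE] := sqmod_psum c N.
under eq_integral do rewrite gE.
rewrite integral_zero_mean// -EFinM mulKf// gt_eqF// mulr_gt0//.
exact: pi_gt0.
Qed.
End parseval.

(** * Square-integrable functions on the circle *)

Section circle.
Context {R : realType}.
Implicit Types (f g h : R -> R[i]) (t a : R).
Local Notation mu := (@lebesgue_measure R).

Lemma measurable_Tint : measurable (@Tint R).
Proof. exact: measurable_itv. Qed.

Lemma meas_on_TD f g : meas_on_T f -> meas_on_T g -> meas_on_T (fun x => f x + g x).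
Proof.
move=> [fp [fr fi]] [gp [gr gi]]; split; last split.
- by move=> x; rewrite fp gp.
- by under eq_fun do rewrite raddfD/=; exact: measurable_funD.
- by under eq_fun do rewrite raddfD/=; exact: measurable_funD.
Qed.

Lemma meas_on_TN f : meas_on_T f -> meas_on_T (fun x => - f x).
Proof.
move=> [fp [fr fi]]; split; last split.
- by move=> x; rewrite fp.
- by under eq_fun do rewrite raddfN/=; exact: measurableT_comp.
- by under eq_fun do rewrite raddfN/=; exact: measurableT_comp.
Qed.

Lemma meas_on_TB f g : meas_on_T f -> meas_on_T g -> meas_on_T (fun x => f x - g x).
Proof. by move=> mf mg; apply: meas_on_TD => //; exact: meas_on_TN. Qed.

Lemma meas_on_T_shift f t : meas_on_T f -> meas_on_T (fun x => f (x - t)).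
Proof.
have mt : measurable_fun setT (fun x : R => x - t) by exact: measurable_funB.
move=> [fp [fr fi]]; split; last split.
- by move=> x; rewrite addrAC fp.
- exact: (measurableT_comp fr mt).
- exact: (measurableT_comp fi mt).
Qed.

Lemma meas_on_T_psum c N : meas_on_T (@psum R c N).
Proof.
elim: N => [|N IH].
  rewrite (_ : psum c 0 = cst 0).
    by split=> //; split; exact: measurable_cst.
  by apply/funext => x; rewrite /psum big_geq.
rewrite (_ : psum c N.+1 = fun x => psum c N x + c N * expi (N%:R * x)); last first.
  by apply/funext => x; rewrite psumS.
apply: meas_on_TD => //.
have mN : measurable_fun setT (fun x : R => N%:R * x) by exact: measurable_funM.
have mc : measurable_fun setT (fun x : R => cos (N%:R * x)).
  apply: (measurableT_comp _ mN).
  by apply: continuous_measurable_fun; exact: continuous_cos.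
have ms : measurable_fun setT (fun x : R => sin (N%:R * x)).
  apply: (measurableT_comp _ mN).
  by apply: continuous_measurable_fun; exact: continuous_sin.
split; first by move=> x; rewrite expi_periodic.
case: (c N) => p q; split=> /=.
- by apply: measurable_funB; exact: measurable_funM.
- by apply: measurable_funD; exact: measurable_funM.
Qed.

Lemma measurable_sqmod f : meas_on_T f ->
  measurable_fun setT (fun x => (sqmod (f x))%:E).
Proof.
move=> [_ [fr fi]]; apply/measurable_EFinP; apply: measurable_funD;
  exact: measurable_funX.
Qed.

Lemma L2Tsq_ge0 f : (0 <= L2Tsq f)%E.
Proof.
apply: mule_ge0; first by rewrite lee_fin invr_ge0 mulr_ge0 ?pi_ge0.
by apply: integral_ge0 => x _; rewrite lee_fin sqmod_ge0.
Qed.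

(** Replaces the triangle inequality for squared norms, at the cost of a factor 3, by integrating
    [sqmodD3_le]. *)
Lemma L2Tsq_D3_le f g h : meas_on_T f -> meas_on_T g -> meas_on_T h ->
  (L2Tsq (fun x => f x + g x + h x)%R <=
   3%:E * (L2Tsq f + L2Tsq g + L2Tsq h))%E.
Proof.
move=> mf mg mh.
have m k : meas_on_T k -> measurable_fun (@Tint R) (fun x => (sqmod (k x))%:E).
  by move=> mk; apply: measurable_funTS; exact: measurable_sqmod.
have p (k : R -> R[i]) (x : R) : (0 <= (sqmod (k x))%:E)%E.
  by rewrite lee_fin sqmod_ge0.
have mT := measurable_Tint.
pose s (k : R -> R[i]) (x : R) := (sqmod (k x))%:E.
have mfg : measurable_fun (@Tint R) (fun x => s f x + s g x)%E.
  by apply: emeasurable_funD; exact: m.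
have mfgh : measurable_fun (@Tint R) (fun x => s f x + s g x + s h x)%E.
  by apply: emeasurable_funD => //; exact: m.
have I3 : (\int[mu]_(x in @Tint R) (s f x + s g x + s h x) =
    \int[mu]_(x in @Tint R) s f x + \int[mu]_(x in @Tint R) s g x +
    \int[mu]_(x in @Tint R) s h x)%E.
  rewrite ge0_integralD//;
    [|by move=> x _; apply: adde_ge0; exact: p|by move=> x _; exact: p|exact: m].
  by rewrite ge0_integralD//; (try exact: m) => x _; exact: p.
have i0 k : (0 <= \int[mu]_(x in @Tint R) s k x)%E.
  by apply: integral_ge0 => x _; exact: p.
rewrite /L2Tsq -[X in (_ <= _ * (X + _))%E]ge0_muleDr//; [|exact: i0|exact: i0].
rewrite -[X in (_ <= _ * X)%E]ge0_muleDr//; last exact: i0.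
  2: by apply: adde_ge0; exact: i0.
rewrite -[X in (_ <= 3%:E * (_ * X))%E]I3 muleCA; apply: lee_wpmul2l.
  by rewrite lee_fin invr_ge0 mulr_ge0 ?pi_ge0.
rewrite -ge0_integralZl//; last by move=> x _; do 2?apply: adde_ge0; exact: p.
apply: ge0_le_integral => //.
- by move=> x _; exact: (p (fun x => f x + g x + h x)).
- by apply: m; do 2?apply: meas_on_TD.
- exact: emeasurable_funM.
- by move=> x _; rewrite -!EFinD -EFinM lee_fin sqmodD3_le.
Qed.

(** By uniqueness of Lebesgue measure it suffices to compare the two measures on half-open
    intervals. *)
Lemma pushforward_lebesgue_shift t (A : set R) : measurable A ->
  pushforward mu (fun x : measurableTypeR R => x - t : measurableTypeR R) A = mu A.
Proof.
have mt : measurable_fun setT (fun x : measurableTypeR R => x - t : measurableTypeR R).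
  exact: measurable_funB.
pose f : {mfun measurableTypeR R >-> measurableTypeR R} :=
  HB.pack (fun x : measurableTypeR R => x - t : measurableTypeR R)
    (isMeasurableFun.Build _ _ _ _ _ mt).
move=> mA; apply/esym/(@lebesgue_measure_unique _ (pushforward mu f)) => //=.
move=> _ [[a b]] _ <-; rewrite /pushforward.
have -> : ((fun x : R => x - t) @^-1` `]a, b] = `]a + t, b + t])%classic.
  apply/seteqP; split => x /=; rewrite !in_itv/=; lra.
rewrite !lebesgue_measure_itv/= !lte_fin ltrD2r; case: ifP => // _.
by rewrite -!EFinB; congr EFin; ring.
Qed.

Lemma ge0_integral_shift t (h : R -> \bar R) (D : set R) : measurable D ->
  measurable_fun setT h -> (forall x, 0 <= h x)%E ->
  (\int[mu]_(x in [set x | D (x - t)%R]%classic) h (x - t)%R =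
   \int[mu]_(x in D) h x)%E.
Proof.
move=> mD mh h0.
have mt : measurable_fun setT (fun x : measurableTypeR R => x - t : measurableTypeR R).
  exact: measurable_funB.
rewrite -[LHS](@ge0_integral_pushforward _ _ _ _ _ _ mt mu D)//.
- apply: eq_measure_integral => //= A mA _.
  exact: pushforward_lebesgue_shift.
- exact: measurable_funTS.
Qed.

(** Both windows contain [[a + s, a + p[]; the remaining pieces [[a, a + s[] and [[a + p, a + s +
    p[] differ by a translation by [p]. *)
Lemma integral_periodic_window (h : R -> \bar R) (a p s : R) : 0 <= s <= p ->
  measurable_fun setT h -> (forall x, 0 <= h x)%E ->
  (forall x, h (x + p) = h x) ->
  (\int[mu]_(x in `[(a + s)%R, (a + s + p)%R]%classic) h x =
   \int[mu]_(x in `[a, (a + p)%R]%classic) h x)%E.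
Proof.
move=> /andP[s0 sp] mh h0 hp.
have mhS D : measurable_fun D h by exact: measurable_funTS.
have int_setU (x y z : R) :
    (\int[mu]_(u in (`[x, y[ `|` `[y, z[)%classic) h u =
     \int[mu]_(u in `[x, y[%classic) h u + \int[mu]_(u in `[y, z[%classic) h u)%E.
  apply: ge0_integral_setU => //; first exact: mhS.
  by apply/disj_setPS => u /= []; rewrite !in_itv/=; lra.
(* Right endpoints are null; without them the pieces of each window are disjoint. *)
rewrite -!integral_itv_bndo_bndc//.
rewrite (@itv_bndbnd_setU _ _ _ (BLeft (a + p))) ?bnd_simp; [|lra|lra].
rewrite [in RHS](@itv_bndbnd_setU _ _ _ (BLeft (a + s))) ?bnd_simp; [|lra|lra].
rewrite !int_setU.
rewrite addeC; congr (_ + _)%E.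
rewrite -(ge0_integral_shift (- p))//.
have -> : [set x | `[(a + p), (a + s + p)[%classic (x - - p)]%classic =
  `[a, (a + s)[%classic.
  apply/seteqP; split => x /=; rewrite !in_itv/=; lra.
by apply: eq_integral => x _; rewrite opprK hp.
Qed.

(** The change of variable moves the window to [[-pi - t, pi - t]], and periodicity brings it
    back. *)
Lemma L2Tsq_shift f t : meas_on_T f -> - pi <= t <= pi ->
  L2Tsq (fun x => f (x - t)) = L2Tsq f.
Proof.
move=> mf /andP[t1 t2]; rewrite /L2Tsq; congr (_ * _)%E.
have mh := measurable_sqmod f mf.
have p0 := pi_gt0 R.
have h0 (x : R) : (0 <= (sqmod (f x))%:E)%E by rewrite lee_fin sqmod_ge0.
have hp (x : R) : (sqmod (f (x + 2 * pi)))%:E = (sqmod (f x))%:E.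
  by case: mf => ->.
transitivity (\int[mu]_(x in `[(- pi - t)%R, (pi - t)%R]%classic)
    (sqmod (f x))%:E)%E.
  rewrite -(ge0_integral_shift t (fun x => (sqmod (f x))%:E))//.
  rewrite (_ : @Tint R = [set x | `[- pi - t, pi - t]%classic (x - t)]%classic)//.
  by apply/seteqP; split => x /=; rewrite /Tint /= !in_itv/=; lra.
(* The sign of [t] decides which of the two windows is the left one. *)
rewrite /Tint; have [t0|t0] := leP 0 t.
  have := integral_periodic_window _ (- pi - t) (2 * pi) t _ mh h0 hp.
  have -> : - pi - t + t = - pi :> R by ring.
  have -> : - pi + 2 * pi = pi :> R by ring.
  have -> : - pi - t + 2 * pi = pi - t :> R by ring.
  by move=> ->//; lra.
have := integral_periodic_window _ (- pi) (2 * pi) (- t) _ mh h0 hp.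
have -> : - pi + 2 * pi = pi :> R by ring.
have -> : - pi - t + 2 * pi = pi - t :> R by ring.
by move=> ->//; lra.
Qed.
End circle.

(** * Oscillation of the boundary function *)

Section boundary.
Context {R : realType}.
Implicit Types (f g F : R -> R[i]) (alpha : nat -> R[i]) (t M : R).
Local Notation mu := (@lebesgue_measure R).

(* By AM-GM, [`|v k| <= q ^+ k * v k ^+ 2 + q ^- k] with [q = 3 / 2]. *)
Lemma cvgn_of_sqr_increments (a : R ^nat) (H : R) :
  (forall n, \sum_(0 <= k < n) (3 / 2) ^+ k * (a k.+1 - a k) ^+ 2 <= H) ->
  cvgn a.
Proof.
move=> hH; pose v k := a k.+1 - a k.
have cv : cvgn (series v).
  apply: normed_cvg; apply: nondecreasing_is_cvgn.
    by apply: nondecreasing_series => n _ _; exact: normr_ge0.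
  exists (H + (1 - 2 / 3)^-1) => _ [n _ <-]; rewrite /series/=.
  apply: (@le_trans _ _ (\sum_(0 <= k < n)
      ((3 / 2) ^+ k * v k ^+ 2 + (2 / 3) ^+ k))).
    apply: ler_sum => k _.
    have -> : (2 / 3) ^+ k = ((3 / 2) ^+ k)^-1 :> R by rewrite -exprVn invf_div.
    have q0 : 0 < (3 / 2) ^+ k :> R by rewrite exprn_gt0// divr_gt0.
    rewrite -(@real_normK _ (v k)) ?num_real//; set q := _ ^+ k in q0 *.
    set w := `|v k|; rewrite -(ler_pM2r q0) mulrDl mulVf ?gt_eqF//.
    have := sqr_ge0 (q * w - 1); have : 0 <= w by exact: normr_ge0.
    nra.
  rewrite big_split/=; apply: lerD; first exact: hH.
  by apply: sum_geometric_le; lra.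
have -> : a = (fun n => series v n + a 0%N).
  by apply/funext => n; rewrite /series/= telescope_sumr// subrK.
by apply: is_cvgD => //; exact: is_cvg_cst.
Qed.

(** Zeroing the first [m] coefficients presents the difference as a single [psum], to which Parseval
    applies. *)
Lemma psumB (alpha : nat -> R[i]) m n x : (m <= n)%N ->
  psum alpha n x - psum alpha m x =
  psum (fun j => if (j < m)%N then 0 else alpha j) n x.
Proof.
move=> mn; rewrite /psum (@big_cat_nat _ _ _ m)//= addrAC subrr add0r.
rewrite [RHS](@big_cat_nat _ _ _ m)//= [X in _ = X + _]big_nat_cond.
rewrite [X in _ = X + _]big1 ?add0r => [|j /andP[/andP[_ ->] _]]; last first.
  by rewrite mul0r.
by apply: eq_big_nat => j /andP[mj _]; rewrite ltnNge mj.
Qed.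

Lemma L2Tsq_psumB alpha m n : (m <= n)%N ->
  L2Tsq (fun x => psum alpha n x - psum alpha m x) =
  (\sum_(m <= j < n) sqmod (alpha j))%:E.
Proof.
move=> mn; rewrite (_ : (fun x => _) =
    psum (fun j => if (j < m)%N then 0 else alpha j) n); last first.
  by apply/funext => x; rewrite psumB.
rewrite L2Tsq_psum; congr EFin.
rewrite (@big_cat_nat _ _ _ m)//= big_nat_cond.
rewrite [X in X + _]big1 ?add0r => [|j /andP[/andP[_ ->] _]]; last first.
  by rewrite /sqmod /= expr0n addr0.
by apply: eq_big_nat => j /andP[mj _]; rewrite ltnNge mj.
Qed.

Lemma L2TsqN f : L2Tsq (fun x => - f x) = L2Tsq f.
Proof. by rewrite /L2Tsq; under eq_integral do rewrite sqmodN. Qed.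

Lemma L2TsqC f g : L2Tsq (fun x => f x - g x) = L2Tsq (fun x => g x - f x).
Proof.
by rewrite -L2TsqN; congr L2Tsq; apply/funext => x; rewrite opprB.
Qed.

(** Write [f_t - f = (f - g)_t + (g_t - g) + (g - f)]; translation invariance removes the shift from
    the first term. It serves both with [g] the boundary function and with [g] a partial sum. *)
Lemma L2Tsq_osc_le f g t : meas_on_T f -> meas_on_T g -> - pi <= t <= pi ->
  (L2Tsq (fun x => f (x - t) - f x)%R <=
   3%:E * (L2Tsq (fun x => f x - g x)%R + L2Tsq (fun x => g (x - t) - g x)%R +
           L2Tsq (fun x => f x - g x)%R))%E.
Proof.
move=> mf mg tpi.
have mfg : meas_on_T (fun x => f x - g x) by exact: meas_on_TB.
rewrite [X in (_ + X)%E]L2TsqC -{1}(L2Tsq_shift _ _ mfg tpi).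
rewrite (_ : (fun x => f (x - t) - f x) = fun x =>
  (f (x - t) - g (x - t)) + (g (x - t) - g x) + (g x - f x)); last first.
  by apply/funext => x; ring.
apply: L2Tsq_D3_le; last exact: meas_on_TB.
- exact: (meas_on_T_shift (fun x => f x - g x)).
- by apply: meas_on_TB => //; exact: meas_on_T_shift.
Qed.

Lemma L2Tsq_psum_osc alpha N t :
  L2Tsq (fun x => psum alpha N (x - t) - psum alpha N x) =
  (\sum_(0 <= n < N) sqmod (alpha n) * sqmod (expi (- (n%:R * t)) - 1))%:E.
Proof.
rewrite (_ : (fun x => _) = psum (fun n => alpha n * (expi (- (n%:R * t)) - 1)) N).
  by rewrite L2Tsq_psum; under eq_bigr do rewrite sqmodM.
by apply/funext => x; rewrite psumB_shift.
Qed.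

Lemma boundary_fun_near alpha F (e : R) : boundary_fun alpha F -> 0 < e ->
  (\forall N \near \oo, (L2Tsq (fun x => psum alpha N x - F x)%R <= e%:E)%E)%classic.
Proof.
move=> [_ cF] e0; apply: (cF [set x | (x <= e%:E)%E]%classic).
suff : nbhs (0 : R) [set r : R | r <= e]%classic by [].
by near=> r; apply: ltW; near: r; exact: lt_nbhsl.
Unshelve. all: by end_near.
Qed.

Lemma Lambda_dyadic_bound alpha F M : boundary_fun alpha F ->
  (forall t, - pi <= t <= pi ->
    (L2Tsq (fun x : R => (F (x - t) - F x)%R) <= (M * `|t|)%:E)%E) ->
  dyadic_bound (fun j => sqmod (alpha j)) (3 * M * pi / 4).
Proof.
move=> bF hM n; have mF := bF.1.
have p0 := pi_gt0 R.
have d1 : 1 <= 2 ^+ n :> R by rewrite exprn_ege1// ler1n.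
(* With this choice [j * t] lies in [[pi / 2, pi]] for every [j] in the n-th block. *)
pose t : R := pi / (2 * 2 ^+ n).
have t0 : 0 < t by rewrite divr_gt0// mulr_gt0//; lra.
have tpi : - pi <= t <= pi.
  apply/andP; split; first by lra.
  by rewrite /t ler_pdivrMr ?ler_peMr//; nra.
have key : 2 * \sum_(2 ^ n <= j < 2 ^ n.+1) sqmod (alpha j) <= 3 * (M * t).
  rewrite -lee_fin; apply/lee_addgt0Pr => e e0.
  (* Two error terms, each multiplied by 3, will add up to [e]. *)
  have e6 : 0 < e / 6 by rewrite divr_gt0.
  have [N _ NP] := boundary_fun_near _ _ _ bF e6.
  pose m := maxn N (2 ^ n.+1).
  have /NP := leq_maxl N (2 ^ n.+1); rewrite -/m /= => Em.
  have mn : (2 ^ n.+1 <= m)%N by exact: leq_maxr.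
  apply: (@le_trans _ _ (L2Tsq (fun x => psum alpha m (x - t) - psum alpha m x))).
    rewrite L2Tsq_psum_osc lee_fin.
    have wk0 j : 0 <= sqmod (alpha j) * sqmod (expi (- (j%:R * t)) - 1).
      by rewrite mulr_ge0// sqmod_ge0.
    rewrite [leRHS](@big_cat_nat _ _ _ (2 ^ n))//=; last first.
      by apply: leq_trans mn; rewrite leq_exp2l.
    rewrite ler_wpDl ?sumr_ge0//.
    rewrite [leRHS](@big_cat_nat _ _ _ (2 ^ n.+1))//= ?leq_exp2l//.
    rewrite ler_wpDr ?sumr_ge0// mulr_sumr; apply: ler_sum_nat => j /andP[j1 j2].
    rewrite mulrC ler_wpM2l ?sqmod_ge0//; apply: sqmod_expiN1_ge2.
    have : 2 ^+ n <= j%:R :> R by rewrite -natrX ler_nat.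
    have : j%:R <= 2 * 2 ^+ n :> R by rewrite -exprS -natrX ler_nat ltnW.
    rewrite /t mulrA ler_pdivlMr ?mulr_gt0 ?ler_pdivrMr ?mulr_gt0//; try lra.
    nra.
  apply: le_trans (L2Tsq_osc_le _ _ _ (meas_on_T_psum alpha m) mF tpi) _.
  apply: (@le_trans _ _ (3%:E * ((e / 6)%:E + (M * t)%:E + (e / 6)%:E))%E).
    apply: lee_wpmul2l; first by rewrite lee_fin.
    apply: leeD => //; apply: leeD => //.
    by have := hM t tpi; rewrite gtr0_norm.
  by rewrite -!EFinD -EFinM lee_fin; lra.
rewrite natrX; set B := bigop _ _ _ in key *.
have : 2 ^+ n * (2 * B) <= 2 ^+ n * (3 * (M * t)) by rewrite ler_pM2l//; lra.
have -> : 2 ^+ n * (3 * (M * t)) = 3 * M * pi / 2.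
  by rewrite /t; field; rewrite gt_eqF//; lra.
lra.
Qed.

Lemma dyadic_bound_Lambda alpha F M : boundary_fun alpha F ->
  dyadic_bound (fun j => sqmod (alpha j)) M -> in_Lambda2_half F.
Proof.
move=> bF hM; have mF := bF.1; split=> //; split.
  have [N _ NP] := boundary_fun_near _ _ _ bF ltr01.
  have mP := meas_on_T_psum alpha N.
  have mz : meas_on_T (fun _ : R => 0 : R[i]).
    by split=> //; split; exact: measurable_cst.
  (* The zero summand gives [F] the shape of the three-term inequality. *)
  rewrite (_ : F = fun x => (F x - psum alpha N x) + psum alpha N x + 0); last first.
    by apply/funext => x; ring.
  apply: le_lt_trans (L2Tsq_D3_le _ _ _ (meas_on_TB _ _ mF mP) mP mz) _.
  have -> : L2Tsq (fun _ : R => 0 : R[i]) = 0%E.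
    rewrite /L2Tsq; under eq_integral do rewrite /sqmod /= expr0n addr0.
    by rewrite integral0 mule0.
  rewrite L2TsqC L2Tsq_psum adde0.
  have /NP /= := leqnn N; set E := L2Tsq _ => E1.
  apply: (@le_lt_trans _ _ (3%:E * (1%:E + (\sum_(0 <= n < N) sqmod (alpha n))%:E))%E).
    by apply: lee_wpmul2l; [rewrite lee_fin|apply: leeD].
  by rewrite -EFinD -EFinM ltry.
(* The factor [12 * M] comes from [dyadic_lipschitz_sum], the 3 from [L2Tsq_osc_le]. *)
exists (3 * (12 * M)) => t tpi; apply/lee_addgt0Pr => e e0.
have e6 : 0 < e / 6 by rewrite divr_gt0.
have [N _ NP] := boundary_fun_near _ _ _ bF e6.
have /NP /= := leqnn N; rewrite L2TsqC => EN.
apply: le_trans (L2Tsq_osc_le _ _ _ mF (meas_on_T_psum alpha N) tpi) _.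
apply: (@le_trans _ _ (3%:E * ((e / 6)%:E + (12 * M * `|t|)%:E + (e / 6)%:E))%E).
  apply: lee_wpmul2l; first by rewrite lee_fin.
  apply: leeD => //; apply: leeD => //.
  rewrite L2Tsq_psum_osc lee_fin; apply: dyadic_lipschitz_sum => //.
  - by move=> n; exact: sqmod_ge0.
  - by move=> n; rewrite sqmod_ge0 sqmod_expiN1_le4.
  - move=> n; apply: le_trans (sqmod_expiN1_le _) _.
    by rewrite !exprMn real_normK ?num_real.
by rewrite -!EFinD -EFinM lee_fin; lra.
Qed.

End boundary.

(** * Construction of the boundary function *)

Section existence.
Context {R : realType}.
Implicit Types (alpha : nat -> R[i]) (x : R).
Local Notation mu := (@lebesgue_measure R).

Lemma integral_sqmod (g : R -> R[i]) :
  (\int[mu]_(x in @Tint R) (sqmod (g x))%:E = (2 * pi)%:E * L2Tsq g)%E.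
Proof.
rewrite /L2Tsq muleA -EFinM mulfV ?mul1e// gt_eqF// mulr_gt0// pi_gt0//.
Qed.

Lemma limn_einf_le (u : (\bar R)^nat) (c : \bar R) :
  (forall n, u n <= c)%E -> (limn_einf u <= c)%E.
Proof.
move=> uc; rewrite limn_einf_lim; apply: lime_le; first exact: is_cvg_einfs.
apply: nearW => n; apply: le_trans (uc n).
by apply: ereal_inf_lbound; exists n => /=.
Qed.

(* The upper limit, unlike [limn], is measurable in parameters even where the
   sequence diverges; there the value is irrelevant. *)
Definition rlimsup (a : R ^nat) : R := fine (limn_esup (fun k => (a k)%:E)).

Lemma cvgn_rlimsup (a : R ^nat) : cvgn a -> (a @ \oo --> rlimsup a)%classic.
Proof.
move=> /cvg_ex[l al]; suff -> : rlimsup a = l by [].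
have al' : ((a k)%:E @[k --> \oo] --> l%:E)%classic.
  by apply/cvg_EFin => //; exact: nearW.
by rewrite /rlimsup (cvg_limn_einf_sup al').2.
Qed.

Lemma measurable_rlimsup (h : (R -> R)^nat) :
  (forall n, measurable_fun setT (h n)) ->
  measurable_fun setT (fun x => rlimsup (h ^~ x)).
Proof.
move=> mh; apply: measurableT_comp; first exact: fine_measurable.
by apply: measurable_fun_limn_esup => n; apply/measurable_EFinP.
Qed.

(** Dyadic partial sums are used because (iii) makes the squared norms of their increments decay
    like [2 ^- k], fast enough for almost everywhere convergence. *)
Definition bdry alpha x : R[i] :=
  ((rlimsup (fun k => complex.Re (psum alpha (2 ^ k) x))) +i*
   (rlimsup (fun k => complex.Im (psum alpha (2 ^ k) x))))%C.

Lemma meas_on_T_bdry alpha : meas_on_T (bdry alpha).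
Proof.
split; last split.
- move=> x; have e k : psum alpha (2 ^ k) (x + 2 * pi) = psum alpha (2 ^ k) x.
    by case: (meas_on_T_psum alpha (2 ^ k)) => ->.
  by rewrite /bdry; under eq_fun do rewrite e;
     under [X in (_ +i* rlimsup X)%C]eq_fun do rewrite e.
- apply: (measurable_rlimsup (fun k x => complex.Re (psum alpha (2 ^ k) x))) => k.
  by case: (meas_on_T_psum alpha (2 ^ k)) => _ [].
- apply: (measurable_rlimsup (fun k x => complex.Im (psum alpha (2 ^ k) x))) => k.
  by case: (meas_on_T_psum alpha (2 ^ k)) => _ [].
Qed.

Definition dyadic_cvg alpha x :=
  cvgn (fun k => complex.Re (psum alpha (2 ^ k) x)) /\
  cvgn (fun k => complex.Im (psum alpha (2 ^ k) x)).

(** The weights [(3 / 2) ^+ k] grow slower than [2 ^+ k], so the weighted squared increments have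
    integrals of order [(3 / 4) ^+ k]. Their sum is then finite almost everywhere, and
    [cvgn_of_sqr_increments] applies to both components. *)
Lemma ae_dyadic_cvg alpha (M : R) :
  dyadic_bound (fun j => sqmod (alpha j)) M ->
  {ae mu, forall x, @Tint R x -> dyadic_cvg alpha x}.
Proof.
move=> hM; have p0 := pi_gt0 R.
pose g k x := psum alpha (2 ^ k.+1) x - psum alpha (2 ^ k) x.
pose s k x := (((3 / 2) ^+ k)%:E * (sqmod (g k x))%:E)%E.
have q0 k : 0 <= (3 / 2) ^+ k :> R by rewrite exprn_ge0// divr_ge0.
have s0 k x : (0 <= s k x)%E by rewrite mule_ge0 ?lee_fin ?sqmod_ge0.
have mT := @measurable_Tint R.
have mg k : measurable_fun (@Tint R) (fun x => (sqmod (g k x))%:E).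
  apply: measurable_funTS; apply: measurable_sqmod.
  by apply: meas_on_TB; exact: meas_on_T_psum.
have ms k : measurable_fun (@Tint R) (s k) by exact: emeasurable_funM.
have ints k : (\int[mu]_(x in @Tint R) s k x <= (2 * pi * M * (3 / 4) ^+ k)%:E)%E.
  rewrite ge0_integralZl//; [|exact: mg|by move=> x _; rewrite lee_fin sqmod_ge0].
  rewrite integral_sqmod L2Tsq_psumB ?leq_exp2l// -!EFinM lee_fin.
  have := hM k; rewrite natrX; set B := bigop _ _ _ => hB.
  have -> : (3 / 4) ^+ k = (3 / 2) ^+ k * (2 ^+ k)^-1 :> R.
    by rewrite -exprVn -exprMn; congr (_ ^+ _); field.
  have d0 : 0 < 2 ^+ k :> R by rewrite exprn_gt0.
  have {hB} : B <= M / 2 ^+ k by rewrite ler_pdivlMr// mulrC.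
  move=> hB; have -> : 2 * pi * M * ((3 / 2) ^+ k / 2 ^+ k) =
    (3 / 2) ^+ k * (2 * pi * (M / 2 ^+ k)) by ring.
  by rewrite ler_wpM2l// ler_wpM2l// mulr_ge0// ltW.
have M0 : 0 <= M.
  apply: le_trans (hM 0%N); rewrite mulr_ge0// sumr_ge0// => *.
  exact: sqmod_ge0.
have iS : (\int[mu]_(x in @Tint R) (\sum_(k <oo) s k x) < +oo)%E.
  rewrite integral_nneseries//.
  apply: (@le_lt_trans _ _ (2 * pi * M * (1 - 3 / 4)^-1)%:E); last exact: ltry.
  apply: lime_le.
    by apply: is_cvg_nneseries => k _ _; apply: integral_ge0.
  apply: nearW => n; apply: (@le_trans _ _
      (\sum_(0 <= k < n) (2 * pi * M * (3 / 4) ^+ k)%:E)%E).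
    by apply: lee_sum => k _; exact: ints.
  rewrite sumEFin lee_fin -mulr_sumr ler_wpM2l//.
    by rewrite !mulr_ge0// ltW.
  by apply: sum_geometric_le; lra.
have : mu.-integrable (@Tint R) (fun x => \sum_(k <oo) s k x)%E.
  apply/integrableP; split.
    by apply: ge0_emeasurable_sum => [k x _ _|k _]; [exact: s0|exact: ms].
  under eq_integral do (rewrite gee0_abs; last by apply: nneseries_ge0).
  exact: iS.
move=> intS; apply: filterS (integrable_ae _ intS) => // x /= h Tx.
have {h} := h Tx; set S := (\sum_(k <oo) _)%E => Sfin.
have hS n : \sum_(0 <= k < n) (3 / 2) ^+ k * sqmod (g k x) <= fine S.
  rewrite -lee_fin fineK// -sumEFin.
  under eq_bigr do rewrite EFinM.
  exact: (nneseries_lim_ge n (fun k _ _ => s0 k x)).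
split; apply: (@cvgn_of_sqr_increments _ _ (fine S)) => n;
  apply: le_trans (hS n); apply: ler_sum => k _; rewrite ler_wpM2l//;
  rewrite /g /sqmod !raddfB/= ?lerDl ?lerDr ?sqr_ge0//.
Qed.

(** By Parseval [||P_(2^(k+N)) - P_N||^2] is at most the tail [tl N]; Fatou's lemma carries this
    bound to the limit in [k], and the tail vanishes because [alpha] is square-summable. *)
Lemma boundary_fun_bdry alpha (M : R) : in_l2 alpha ->
  dyadic_bound (fun j => sqmod (alpha j)) M -> boundary_fun alpha (bdry alpha).
Proof.
move=> al2 hM; split; first exact: meas_on_T_bdry.
pose tl N := (\sum_(N <= j <oo) (sqmod (alpha j))%:E)%E.
have a0 j : (0 <= (sqmod (alpha j))%:E)%E by rewrite lee_fin sqmod_ge0.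
have tl0 : (tl @ \oo --> 0%E)%classic.
  by apply: nneseries_tail_cvg => // k _; exact: a0.
have mT := @measurable_Tint R.
suff le_tl N : (L2Tsq (fun x => psum alpha N x - bdry alpha x)%R <= tl N)%E.
  apply: (@squeeze_cvge _ _ _ _ (fun=> 0%E) _ tl) => //; last exact: cvg_cst.
  by apply: nearW => N; rewrite L2Tsq_ge0 le_tl.
(* The exponent [k + N] ensures [N <= 2 ^ (k + N)] for every [k]. *)
pose P k x := psum alpha (2 ^ (k + N)) x - psum alpha N x.
have mP k : measurable_fun (@Tint R) (fun x => (sqmod (P k x))%:E).
  apply: measurable_funTS; apply: measurable_sqmod.
  by apply: meas_on_TB; exact: meas_on_T_psum.
have iP k : (\int[mu]_(x in @Tint R) (sqmod (P k x))%:E <= (2 * pi)%:E * tl N)%E.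
  have Nk : (N <= 2 ^ (k + N))%N.
    by rewrite (leq_trans _ (ltnW (ltn_expl _ _)))// leq_addl.
  rewrite integral_sqmod L2Tsq_psumB//; apply: lee_wpmul2l.
    by rewrite lee_fin mulr_ge0// pi_ge0.
  by rewrite -sumEFin; apply: nneseries_lim_ge.
suff : (\int[mu]_(x in @Tint R) (sqmod (psum alpha N x - bdry alpha x))%:E <=
    (2 * pi)%:E * tl N)%E.
  rewrite integral_sqmod lee_pmul2l//.
  by rewrite lte_fin mulr_gt0// pi_gt0.
apply: le_trans (limn_einf_le _ _ iP).
apply: (@le_trans _ _
  (\int[mu]_(x in @Tint R) limn_einf (fun k => (sqmod (P k x))%:E))%E); last first.
  by apply: fatou => // k x _; rewrite lee_fin sqmod_ge0.
apply: ae_ge0_le_integral => //.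
- by move=> x _; rewrite lee_fin sqmod_ge0.
- apply: measurable_funTS; apply: measurable_sqmod.
  by apply: meas_on_TB; [exact: meas_on_T_psum|exact: meas_on_T_bdry].
- move=> x _; rewrite limn_einf_lim; apply: lime_ge; first exact: is_cvg_einfs.
  apply: nearW => n; apply: le_ereal_inf_tmp => _ [k _ <-].
  by rewrite lee_fin sqmod_ge0.
- rewrite /limn_einf; apply: measurableT_comp => //.
  apply: measurable_fun_limn_esup => k; apply: measurableT_comp => //.
  exact: mP.
(* Where the dyadic partial sums converge, the lower limit is a limit and equals the integrand on
   the left. *)
apply: (@filterS _ _ (ae_filter_ringOfSetsType mu)
  _ _ _ (ae_dyadic_cvg _ _ hM)) => x /= h Tx.
have {h} [/cvgn_rlimsup cr /cvgn_rlimsup ci] := h Tx.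
have : ((sqmod (P k x))%:E @[k --> \oo] -->
    (sqmod (psum alpha N x - bdry alpha x))%:E)%classic.
  apply/cvg_EFin; first exact: nearW.
  rewrite -(sqmodN (_ - _)) opprB.
  have e1 : (complex.Re (P k x) @[k --> \oo] -->
      complex.Re (bdry alpha x - psum alpha N x))%classic.
    rewrite raddfB /P/=; under eq_fun do rewrite raddfB/=.
    apply: cvgB; last exact: cvg_cst.
    by rewrite (cvg_shiftn N (fun k => complex.Re (psum alpha (2 ^ k) x))).
  have e2 : (complex.Im (P k x) @[k --> \oo] -->
      complex.Im (bdry alpha x - psum alpha N x))%classic.
    rewrite raddfB /P/=; under eq_fun do rewrite raddfB/=.
    apply: cvgB; last exact: cvg_cst.
    by rewrite (cvg_shiftn N (fun k => complex.Im (psum alpha (2 ^ k) x))).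
  by apply: cvgD; under eq_fun do rewrite expr2; apply: cvgM.
by move=> /cvg_limn_einf_sup[-> _].
Qed.

End existence.

Theorem theorem1p1 (R : realType) (alpha : nat -> R[i]) (halpha : in_l2 alpha) :
  [<-> rhaly_bounded alpha;
       exists F : R -> R[i], boundary_fun alpha F /\ in_Lambda2_half F;
       exists M : R, forall n : nat,
         (2 ^ n)%:R * \sum_((2 ^ n)%N <= j < (2 ^ n.+1)%N) sqmod (alpha j) <= M].
Proof.
tfae.
(* The dyadic bound comes first; it yields both the boundary function and its oscillation
   estimate. *)
- move=> /rhaly_bounded_dyadic[M hM]; exists (bdry alpha).
  have bF := boundary_fun_bdry _ _ halpha hM.
  by split=> //; exact: dyadic_bound_Lambda bF hM.
- move=> [F [bF [_ [_ [M hM]]]]]; exists (3 * M * pi / 4).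
  exact: Lambda_dyadic_bound bF hM.
- by move=> [M hM]; exact: dyadic_rhaly_bounded hM.
Qed.
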